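(* Let $M$ be any fixed non-empty set (finite or infinite), let $\Gamma$ be a finite set of MD-sentences with domain $M$ and let $\gamma$ be an MD-sentence with domain $M$. Then $\Gamma \vdash_M \gamma$ if and only if $\Gamma \vDash_M \gamma$.
   Context: Fix a real-valued logic, i.e. a collection of connectives, each $n$-ary connective $\circ$ being interpreted by a function $\circ\colon[0,1]^n\to[0,1]$, and a first-order relational vocabulary $\tau$. Formulas are built from atomic formulas with the connectives and the quantifiers $\forall,\exists$. Models. A model $\mathfrak M$ with domain $M$ interprets each $n$-ary predicate $R\in\tau$ by a map $R_{\mathfrak M}\colon M^n\to[0,1]$. Truth-values: $\|P[\overline a]\|_{\mathfrak M}=P_{\mathfrak M}(\overline a)$; $\|\circ(\varphi_1,\ldots,\varphi_n)[\overline a]\|_{\mathfrak M}=\circ(\|\varphi_1[\overline a]\|_{\mathfrak M},\ldots,\|\varphi_n[\overline a]\|_{\mathfrak M})$; $\|(\forall x)\varphi[\overline a]\|_{\mathfrak M}=\inf\{\|\varphi[\overline a,e]\|_{\mathfrak M}\mid e\in M\}$; $\|(\exists x)\varphi[\overline a]\|_{\mathfrak M}=\sup\{\|\varphi[\overline a,e]\|_{\mathfrak M}\mid e\in M\}$. If the vocabulary includes the equality symbol $\approx$, then $\|(x\approx y)[d,e]\|_{\mathfrak M}$ is $1$ if $d=e$ and $0$ if $d\ne e$. A formula $\varphi(x_1,\ldots,x_n)$ is interpreted in (defines in) $\mathfrak M$ the map $M^n\to[0,1]$, $(a_1,\ldots,a_n)\mapsto\|\varphi[a_1,\ldots,a_n]\|_{\mathfrak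 M}$ (an element of $[0,1]$ if $n=0$). MD-sentences. An MD-sentence with domain $M$ is an expression $\langle\varphi_1(\overline x_{\varphi_1}),\ldots,\varphi_k(\overline x_{\varphi_k});S\rangle$, where each $\varphi_i$ is a first-order formula whose free variables are exactly those in the list $\overline x_{\varphi_i}=x_{i_1},\ldots,x_{i_{n_i}}$ and $S\subseteq[0,1]^{M^{n_1}}\times\cdots\times[0,1]^{M^{n_k}}$. A model $\mathfrak M$ with domain $M$ satisfies it, written $\mathfrak M\models\langle\varphi_1,\ldots,\varphi_k;S\rangle$, if the maps $f_1,\ldots,f_k$ defined by $\varphi_1,\ldots,\varphi_k$ in $\mathfrak M$ satisfy $\langle f_1,\ldots,f_k\rangle\in S$. $\Gamma\vDash_M\gamma$ means that every model with domain $M$ that satisfies all members of $\Gamma$ satisfies $\gamma$. Good tuples. For a $j$-ary connective $\circ$ and functions $f_1,\ldots,f_j$ from Cartesian powers of $M$ to $[0,1]$ associated with formulas, $\circ(f_1,\ldots,f_j)$ is the function obtained by applying $\circ$ to the outputs of the $f_i$'s (arguments being taken componentwise, matched according to the free variables). Given an MD-sentence $\langle\varphi_1,\ldots,\varphi_k;S\rangle$, a tuple $\langle f_1,\ldots,f_k\rangle\in S$ is good if: (a) $f_m=\circ(f_{m_1},\ldots,f_{m_j})$ whenever $\varphi_m=\circ(\varphi_{m_1},\ldots,\varphi_{m_j})$; (b) whenever $\varphi_i=\forall y\,\varphi_j$, $f_i(e_1,\ldots,e_{n_i})=\inf\{f_j(e_1,\ldots,e_{n_i},e)\mid e\in M\}$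 for all $e_1,\ldots,e_{n_i}\in M$; (c) whenever $\varphi_i=\exists y\,\varphi_j$, $f_i(e_1,\ldots,e_{n_i})=\sup\{f_j(e_1,\ldots,e_{n_i},e)\mid e\in M\}$ for all $e_1,\ldots,e_{n_i}\in M$ (in (b),(c) $e$ is placed in the argument position of $y$). Proof system (the MD-system of $M$). Axiom (1): $\langle\varphi_1,\ldots,\varphi_k;[0,1]^{M^{n_1}}\times\cdots\times[0,1]^{M^{n_k}}\rangle$ for all formulas $\varphi_1,\ldots,\varphi_k$. Rule (2): from $\langle\varphi_1,\ldots,\varphi_k;S\rangle$ infer $\langle\varphi_{\pi(1)},\ldots,\varphi_{\pi(k)};S'\rangle$, where $\pi$ is a permutation of $1,\ldots,k$ and $S'=\{\langle f_{\pi(1)},\ldots,f_{\pi(k)}\rangle\mid\langle f_1,\ldots,f_k\rangle\in S\}$. Rule (3): from $\langle\varphi_1,\ldots,\varphi_k;S\rangle$ infer $\langle\varphi_1,\ldots,\varphi_k,\varphi_{k+1},\ldots,\varphi_m;S\times[0,1]^{M^{n_{k+1}}}\times\cdots\times[0,1]^{M^{n_m}}\rangle$. Rule (4): from $\langle\varphi_1,\ldots,\varphi_k;S_1\rangle$ and $\langle\varphi_1,\ldots,\varphi_k;S_2\rangle$ infer $\langle\varphi_1,\ldots,\varphi_k;S_1\cap S_2\rangle$. Rule (5): for $0<r<k$, from $\langle\varphi_1,\ldots,\varphi_k;S\rangle$ infer $\langle\varphi_1,\ldots,\varphi_{k-r};S'\rangle$, where $S'=\{\langle f_1,\ldots,f_{k-r}\rangle\mid\langle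 f_1,\ldots,f_k\rangle\in S\}$. Rule (6): from $\langle\varphi_1,\ldots,\varphi_k;S\rangle$ infer $\langle\varphi_1,\ldots,\varphi_k;S'\rangle$ whenever $S\subseteq S'$. Rule (7): from $\langle\varphi_1,\ldots,\varphi_k;S\rangle$ infer $\langle\varphi_1,\ldots,\varphi_k;S'\rangle$, where $S'$ is the set of good tuples in $S$. $\Gamma\vdash_M\gamma$ means that there is a finite sequence of MD-sentences ending in $\gamma$, each element of which is an axiom, a member of $\Gamma$, or follows from previous elements by one of the rules.
   Formalization: Rule (7) here also requires components that are atomic formulas with the same predicate to be instances of one map, and equality to be crisp; with (a)–(c) alone completeness fails: ⟨P(x),P(y);{f1≠f2}⟩ has no model but is not refutable. *)

(* Defs.v *)
From Stdlib Require List.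
From mathcomp Require Import all_boot all_order all_algebra fingroup perm.
From mathcomp Require Import mathcomp_extra boolp classical_sets functions.
From mathcomp Require Import cardinality reals interval_inference.

Set Implicit Arguments.
Unset Strict Implicit.
Unset Printing Implicit Defensive.

Import Order.TTheory GRing.Theory Num.Theory.

Local Open Scope classical_set_scope.
Local Open Scope ring_scope.

Section InfSup01.
Context {R : realType}.
Implicit Type A : set {i01 R}.

(* On the empty set [inf] and [sup] are 0, so the bounds hold for every [A]. *)
Lemma inf01_ge0 A : 0 <= inf [set x%:inum | x in A] :> R.
Proof.
have [->|/set0P[x Ax]] := eqVneq A set0; first by rewrite image_set0 inf0.
apply: lb_le_inf; first by exists x%:inum, x.
by move=> _ [y _ <-].
Qed.

Lemma inf01_le1 A : inf [set x%:inum | x in A] <= 1 :> R.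
Proof.
have [->|/set0P[x Ax]] := eqVneq A set0; first by rewrite image_set0 inf0 ler01.
apply: (@le_trans _ _ x%:inum) => //.
by apply: ge_inf; [exists 0 => _ [y _ <-] | exists x].
Qed.

Lemma sup01_ge0 A : 0 <= sup [set x%:inum | x in A] :> R.
Proof.
have [->|/set0P[x Ax]] := eqVneq A set0; first by rewrite image_set0 sup0.
apply: (@le_trans _ _ x%:inum) => //.
by apply: ub_le_sup; [exists 1 => _ [y _ <-] | exists x].
Qed.

Lemma sup01_le1 A : sup [set x%:inum | x in A] <= 1 :> R.
Proof.
have [->|/set0P[x Ax]] := eqVneq A set0; first by rewrite image_set0 sup0 ler01.
apply: ge_sup; first by exists x%:inum, x.
by move=> _ [y _ <-].
Qed.

Definition inf01 A : {i01 R} := Itv01 (inf01_ge0 A) (inf01_le1 A).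
Definition sup01 A : {i01 R} := Itv01 (sup01_ge0 A) (sup01_le1 A).

End InfSup01.

Record rv_logic (R : realType) := RVLogic {
  conn : Type;
  conn_arity : conn -> nat;
  conn_fun : forall c : conn, ('I_(conn_arity c) -> {i01 R}) -> {i01 R} }.

Record vocabulary := Vocabulary {
  pred_sym : Type;
  pred_arity : pred_sym -> nat;
  has_eq : bool }.

(* The variables are the natural numbers. *)
Inductive formula (R : realType) (L : rv_logic R) (tau : vocabulary) :=
| Atom (P : pred_sym tau) of (pred_arity P).-tuple nat
| Equal of has_eq tau & nat & nat
| Conn (c : conn L) of ('I_(conn_arity c) -> formula L tau)
| All of nat & formula L tau
| Ex of nat & formula L tau.

Arguments Atom {R L tau} P xs.
Arguments Equal {R L tau} h x y.
Arguments Conn {R L tau} c phis.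
Arguments All {R L tau} y phi.
Arguments Ex {R L tau} y phi.

Record model (R : realType) (tau : vocabulary) (M : Type) := Model {
  interp : forall P : pred_sym tau, (pred_arity P).-tuple M -> {i01 R} }.

Section Semantics.
Context {R : realType} {L : rv_logic R} {tau : vocabulary} {M : pointedType}.
Implicit Types (phi : formula L tau) (MM : model R tau M) (e : nat -> M).

Fixpoint free_vars phi : seq nat :=
  match phi with
  | Atom _ xs => xs
  | Equal _ x y => [:: x; y]
  | Conn _ phis => flatten [seq free_vars (phis i) | i : 'I_ _]
  | All y psi | Ex y psi => [seq x <- free_vars psi | x != y]
  end.

Definition fv phi : seq nat := sort leq (undup (free_vars phi)).

Definition eq01 (d d' : M) : {i01 R} := if d == d' then 1%:i01 else 0%:i01.

Fixpoint eval MM phi e : {i01 R} :=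
  match phi with
  | Atom P xs => interp MM (map_tuple e xs)
  | Equal _ x y => eq01 (e x) (e y)
  | Conn c phis => conn_fun (fun i => eval MM (phis i) e)
  | All y psi => inf01 [set eval MM psi [eta e with y |-> d] | d in [set: M]]
  | Ex y psi => sup01 [set eval MM psi [eta e with y |-> d] | d in [set: M]]
  end.

(* The maps [M^n -> [0,1]], where [n] is the number of free variables of [phi];
   the i-th argument is the value of the i-th variable of [fv phi]. *)
Definition fmap phi := (size (fv phi)).-tuple M -> {i01 R}.

(* The map defined by [phi]; [point] is only given to variables that are not
   free in [phi]. *)
Definition defined_map MM phi : fmap phi :=
  fun a => eval MM phi (fun x => nth point a (index x (fv phi))).

(* Arguments are matched by variable: [app f e] applies [f] to the values in [e]
   of the free variables of [phi]. As [fv phi] has no repetition, every tuple of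
   arguments of [f] comes from some [e]. *)
Definition app phi (f : fmap phi) e : {i01 R} :=
  f (map_tuple e (in_tuple (fv phi))).

End Semantics.

Arguments fmap {R L tau} M phi.
Arguments defined_map {R L tau M} MM phi a.
Arguments app {R L tau M phi} f e.

(* The components are numbered by ['I_md_len.+1]: there is at least one. *)
Record md_sentence (R : realType) (L : rv_logic R) (tau : vocabulary)
    (M : pointedType) := MD {
  md_len : nat;
  md_form : 'I_md_len.+1 -> formula L tau;
  md_set : set (forall i, fmap M (md_form i)) }.

Arguments MD {R L tau M md_len} md_form md_set.
Arguments md_form {R L tau M} delta i : rename.
Arguments md_set {R L tau M} delta f : rename.

Section MDSystem.
Context {R : realType} {L : rv_logic R} {tau : vocabulary} {M : pointedType}.
Implicit Types (MM : model R tau M) (delta gamma : md_sentence L tau M)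
  (Gamma : set (md_sentence L tau M)).

Definition satisfies MM delta : Prop :=
  md_set delta (fun i => defined_map MM (md_form delta i)).

Definition entails Gamma gamma : Prop :=
  forall MM, (forall delta, Gamma delta -> satisfies MM delta) ->
    satisfies MM gamma.

Section Good.
Context {k : nat} {phi : 'I_k -> formula L tau}.
Implicit Type f : forall i, fmap M (phi i).

Definition good f : Prop :=
  [/\ forall m c (h : 'I_(conn_arity c) -> 'I_k),
        phi m = Conn c (fun l => phi (h l)) ->
        forall e, app (f m) e = conn_fun (fun l => app (f (h l)) e),
      forall i j y, phi i = All y (phi j) ->
        forall e, app (f i) e =
          inf01 [set app (f j) [eta e with y |-> d] | d in [set: M]]
    & forall i j y, phi i = Ex y (phi j) ->
        forall e, app (f i) e =
          sup01 [set app (f j) [eta e with y |-> d] | d in [set: M]]].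

(* The maps given to atomic formulas with the same predicate symbol are
   instances of one map, and equality is crisp. [good] does not imply this: for
   distinct variables [x] and [y], the sentence [< P(x), P(y); S >] with [S] the
   set of pairs of distinct maps has no model, but all pairs in [S] are good.
   Without this condition the system would not refute that sentence. *)
Definition coherent_atoms f : Prop :=
  (forall i j P xs ys, phi i = Atom P xs -> phi j = Atom P ys ->
     forall e e' : nat -> M, map_tuple e xs = map_tuple e' ys ->
       app (f i) e = app (f j) e') /\
  (forall i h x y, phi i = Equal h x y ->
     forall e, app (f i) e = eq01 (e x) (e y)).

End Good.

(* [infer prev delta]: [delta] is an axiom or follows by a rule from sentences
   satisfying [prev]. *)
Inductive infer (prev : md_sentence L tau M -> Prop) :
    md_sentence L tau M -> Prop :=
| Axiom_full k (phi : 'I_k.+1 -> formula L tau) : infer prev (MD phi setT)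
| Rule_perm k (phi : 'I_k.+1 -> formula L tau) S (s : 'S_k.+1) :
    prev (MD phi S) ->
    infer prev (MD (fun i => phi (s i)) [set (fun i => f (s i)) | f in S])
| Rule_extend k m (le_km : (k.+1 <= m.+1)%N) (phi : 'I_m.+1 -> formula L tau) S :
    prev (MD (fun i => phi (widen_ord le_km i)) S) ->
    infer prev (MD phi [set f | S (fun i => f (widen_ord le_km i))])
| Rule_inter k (phi : 'I_k.+1 -> formula L tau) S1 S2 :
    prev (MD phi S1) -> prev (MD phi S2) -> infer prev (MD phi (S1 `&` S2))
| Rule_project k m (lt_km : (k.+1 < m.+1)%N) (phi : 'I_m.+1 -> formula L tau) S :
    prev (MD phi S) ->
    infer prev (MD (fun i => phi (widen_ord (ltnW lt_km) i))
                   [set (fun i => f (widen_ord (ltnW lt_km) i)) | f in S])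
| Rule_weaken k (phi : 'I_k.+1 -> formula L tau) S S' :
    S `<=` S' -> prev (MD phi S) -> infer prev (MD phi S')
| Rule_good k (phi : 'I_k.+1 -> formula L tau) S :
    prev (MD phi S) ->
    infer prev (MD phi [set f | [/\ S f, good f & coherent_atoms f]]).

Inductive derivation Gamma : seq (md_sentence L tau M) -> Prop :=
| Derivation_nil : derivation Gamma [::]
| Derivation_rcons s delta : derivation Gamma s ->
    Gamma delta \/ infer (fun d => List.In d s) delta ->
    derivation Gamma (rcons s delta).

Definition derives Gamma gamma : Prop :=
  exists s, derivation Gamma (rcons s gamma).

End MDSystem.

(* Main.v *)
Require Import Defs.
From HB Require Import structures.
From Stdlib Require List.
From mathcomp Require Import all_boot all_algebra fingroup perm.
From mathcomp Require Import boolp classical_sets.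
From mathcomp Require Import cardinality reals interval_inference.
From mathcomp Require Import zify.

(** Soundness is a check of each rule; the only one with content is the rule that
keeps the good tuples, which needs that the maps defined in a model are good.
That holds because the value of a formula depends on its free variables only
([eval_eq_free_vars]), so that applying the map defined by a formula to an
assignment gives back the value of the formula ([app_defined_map]).

For completeness, take a finite list of formulas that contains, as disjoint
blocks, the components of every member of [Gamma] and of [gamma], and that is
closed under subformulas ([common_closed_formulas]). Extension and permutation
rewrite each member of [Gamma] as a sentence over this common list that has the
same models ([derives_pullback]). Finitely many intersections join them into one
sentence ([derives_inter_seq]), and this is where the finiteness of [Gamma] is
used. The good-tuple rule then restricts its set to the tuples that are good and
coherent on atoms. The central fact is that, over a list closed under
subformulas, these are precisely the tuples defined by models
([good_defined_maps], [coherent_atoms_defined_maps], [good_has_model]): the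
values on atomic formulas can be read as a model, and goodness forces the other
components by induction on formulas. So each tuple left in the set comes from a model of [Gamma], hence, by hypothesis, of [gamma];
its block for [gamma] lies in the set of [gamma], and permuting this block to
the front, projecting and weakening derives [gamma] ([derives_restrict]).

The maps in a tuple have types that depend on the formulas, so sentences over
different lists cannot be compared directly. The steps of the proof are
therefore stated through the models of the sentences, and tuples are transported
only along permutations of one list ([reindex_perm_surj]). *)

Set Implicit Arguments.
Unset Strict Implicit.
Unset Printing Implicit Defensive.

Local Open Scope classical_set_scope.

HB.instance Definition _ (R : realType) (L : rv_logic R) (tau : vocabulary) :=
  gen_eqMixin (formula L tau).

HB.instance Definition _ (R : realType) (L : rv_logic R) (tau : vocabulary)
    (M : pointedType) := gen_eqMixin (md_sentence L tau M).

(** * Defined maps and free variables *)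

Section DefinedMaps.
Context {R : realType} {L : rv_logic R} {tau : vocabulary} {M : pointedType}.
Implicit Types (phi psi : formula L tau) (MM : model R tau M) (e : nat -> M).

Lemma eval_eq_free_vars MM phi e e' :
  {in free_vars phi, e =1 e'} -> eval MM phi e = eval MM phi e'.
Proof.
elim: phi e e' => [P xs|h x y|c ps IH|y psi IH|y psi IH] e e' ee' /=.
- congr interp; apply: val_inj => /=.
  by apply/eq_in_map => x; exact: ee'.
- by rewrite !ee' //= !inE eqxx ?orbT.
- congr conn_fun; apply: functional_extensionality_dep => i.
  apply: IH => x xi; apply: ee' => /=.
  by apply/flatten_mapP; exists i; rewrite ?mem_enum.
- congr inf01; apply: eq_imagel => d _; apply: IH => x xpsi /=.
  by case: eqVneq => // xy; apply: ee'; rewrite /= mem_filter xy.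
- congr sup01; apply: eq_imagel => d _; apply: IH => x xpsi /=.
  by case: eqVneq => // xy; apply: ee'; rewrite /= mem_filter xy.
Qed.

Lemma mem_fv phi : fv phi =i free_vars phi.
Proof. by move=> x; rewrite /fv mem_sort mem_undup. Qed.

Lemma uniq_fv phi : uniq (fv phi).
Proof. by rewrite /fv sort_uniq undup_uniq. Qed.

Lemma app_defined_map MM phi e : app (defined_map MM phi) e = eval MM phi e.
Proof.
apply: eval_eq_free_vars => x; rewrite -mem_fv => xphi /=.
by rewrite (nth_map 0) ?index_mem// nth_index.
Qed.

(** As [fv phi] has no repetition, every tuple of arguments of a map is read off
    some assignment. *)
Lemma app_inj phi (f g : fmap M phi) : app f =1 app g -> f = g.
Proof.
move=> fg; apply: functional_extensionality_dep => a.
suff <- : map_tuple (fun x => nth point a (index x (fv phi)))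
    (in_tuple (fv phi)) = a by exact: fg.
apply: val_inj => /=; apply: (@eq_from_nth _ point) => [|i].
  by rewrite size_map size_tuple.
rewrite size_map => ltin.
by rewrite (nth_map 0)// index_uniq// uniq_fv.
Qed.

End DefinedMaps.

(** * Soundness *)

Section Soundness.
Context {R : realType} {L : rv_logic R} {tau : vocabulary} {M : pointedType}.
Implicit Types (MM : model R tau M) (delta gamma : md_sentence L tau M)
  (Gamma : set (md_sentence L tau M)).

(** Through [app_defined_map], the clauses of goodness are the clauses that
    define [eval]. *)
Lemma good_defined_maps MM k (phi : 'I_k -> formula L tau) :
  good (fun i => defined_map MM (phi i)).
Proof.
split=> [m c h phim|i j y phii|i j y phii] e.
- rewrite app_defined_map phim /=.
  congr conn_fun; apply: functional_extensionality_dep => l.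
  by rewrite app_defined_map.
- rewrite app_defined_map phii /=.
  by congr inf01; apply: eq_imagel => d _; rewrite app_defined_map.
- rewrite app_defined_map phii /=.
  by congr sup01; apply: eq_imagel => d _; rewrite app_defined_map.
Qed.

Lemma coherent_atoms_defined_maps MM k (phi : 'I_k -> formula L tau) :
  coherent_atoms (fun i => defined_map MM (phi i)).
Proof.
split=> [i j P xs ys phii phij e e' ee'|i h x y phii e].
  by rewrite !app_defined_map phii phij /= ee'.
by rewrite app_defined_map phii.
Qed.

Lemma infer_sound MM (prev : md_sentence L tau M -> Prop) delta :
  (forall d, prev d -> satisfies MM d) -> infer prev delta ->
  satisfies MM delta.
Proof.
move=> prevMM [k phi|k phi S s /prevMM MMS|k m le_km phi S /prevMM MMS
  |k phi S1 S2 /prevMM MMS1 /prevMM MMS2|k m lt_km phi S /prevMM MMS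
  |k phi S S' SS' /prevMM MMS|k phi S /prevMM MMS] //; rewrite /satisfies /=.
- by exists (fun i => defined_map MM (phi i)).
- by exists (fun i => defined_map MM (phi i)).
- exact: SS'.
- split=> //; first exact: good_defined_maps.
  exact: coherent_atoms_defined_maps.
Qed.

Lemma soundness Gamma gamma : derives Gamma gamma -> entails Gamma gamma.
Proof.
move=> [s ders] MM MMGamma.
suff : forall d, List.In d (rcons s gamma) -> satisfies MM d.
  by apply; rewrite -cats1; apply/List.in_app_iff; right; left.
elim: ders => // {}s d _ IH dP x; rewrite -cats1.
case/List.in_app_iff => [|[<-|//]]; first exact: IH.
by case: dP => [/MMGamma//|]; apply: infer_sound.
Qed.

End Soundness.

(** * Derivability is closed under the rules *)

Section Derivations.
Context {R : realType} {L : rv_logic R} {tau : vocabulary} {M : pointedType}.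
Implicit Types (delta gamma : md_sentence L tau M)
  (Gamma : set (md_sentence L tau M)) (prev : md_sentence L tau M -> Prop).

Lemma sub_infer prev prev' delta :
  (forall d, prev d -> prev' d) -> infer prev delta -> infer prev' delta.
Proof.
move=> pp' [k phi|k phi S s /pp'|k m le_km phi S /pp'
  |k phi S1 S2 /pp' p1 /pp' p2|k m lt_km phi S /pp'
  |k phi S S' SS' /pp'|k phi S /pp'].
- exact: Axiom_full.
- exact: Rule_perm.
- exact: Rule_extend.
- exact: Rule_inter.
- exact: Rule_project.
- exact: Rule_weaken.
- exact: Rule_good.
Qed.

Lemma derivation_cat Gamma s1 s2 :
  derivation Gamma s1 -> derivation Gamma s2 -> derivation Gamma (s1 ++ s2).
Proof.
move=> d1; elim=> [|s d _ IH dP]; first by rewrite cats0.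
rewrite -rcons_cat; apply: Derivation_rcons => //.
case: dP => [|dP]; [by left | right].
by apply: sub_infer dP => x xs; apply/List.in_app_iff; right.
Qed.

(** Every rule has finitely many premises; this is what lets a statement about
    derivations, which are finite sequences, be turned into a closure property
    of derivability. *)
Lemma infer_finite_premises prev delta : infer prev delta ->
  exists2 s, (forall d, List.In d s -> prev d) &
             infer (fun d => List.In d s) delta.
Proof.
move=> [k phi|k phi S s p|k m le_km phi S p|k phi S1 S2 p1 p2
  |k m lt_km phi S p|k phi S S' SS' p|k phi S p].
- by exists [::] => //; exact: Axiom_full.
- exists [:: MD phi S]; first by move=> d [<-|].
  by apply: Rule_perm; left.
- exists [:: MD (fun i => phi (widen_ord le_km i)) S]; first by move=> d [<-|].
  by apply: Rule_extend; left.
- exists [:: MD phi S1; MD phi S2]; first by move=> d [<-|[<-|]].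
  by apply: Rule_inter; [left | right; left].
- exists [:: MD phi S]; first by move=> d [<-|].
  by apply: Rule_project; left.
- exists [:: MD phi S]; first by move=> d [<-|].
  by apply: (Rule_weaken SS'); left.
- exists [:: MD phi S]; first by move=> d [<-|].
  by apply: Rule_good; left.
Qed.

(** Derivations of the finitely many premises can be concatenated, and rules
    keep applying when more sentences are available. *)
Lemma derives_infer Gamma delta :
  infer (derives Gamma) delta -> derives Gamma delta.
Proof.
case/infer_finite_premises => s sG infs.
have [t dert st] : exists2 t, derivation Gamma t &
    forall d, List.In d s -> List.In d t.
  elim: s sG {infs} => [|d s IH] sG; first by exists [::] => //; left.
  have [|t dert st] := IH; first by move=> x xs; apply: sG; right.
  have [|u deru] := sG d; first by left.
  exists (rcons u d ++ t); first exact: derivation_cat.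
  move=> x [<-|/st xt]; apply/List.in_app_iff; [left|by right].
  by rewrite -cats1; apply/List.in_app_iff; right; left.
exists t; apply: Derivation_rcons => //; right.
exact: sub_infer infs.
Qed.

Lemma derives_mem Gamma delta : Gamma delta -> derives Gamma delta.
Proof.
move=> Gd; exists [::]; apply: Derivation_rcons; [|by left].
exact: Derivation_nil.
Qed.

End Derivations.

(** * Moving sentences along injections of their index sets *)

Lemma perm_extending_inj k m (le_km : k <= m) (h : 'I_k -> 'I_m) :
  injective h -> exists s : 'S_m, forall i, s (widen_ord le_km i) = h i.
Proof.
case: m => [|m] in le_km h * => h_inj.
  by exists 1%g => i; case: (h i).
(* The permutation lists the values of [h] first, then the other indices. *)
set u := codom h ++ [seq j <- enum 'I_m.+1 | j \notin codom h].
have uniq_u : uniq u.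
  rewrite cat_uniq filter_uniq ?enum_uniq// andbT.
  apply/andP; split; first exact/injectiveP.
  by apply/hasPn => j; rewrite mem_filter => /andP[].
have size_u : size u = m.+1.
  rewrite -[RHS]size_enum_ord; apply/perm_size/uniq_perm; rewrite ?enum_uniq//.
  by move=> j; rewrite mem_cat mem_filter mem_enum andbT orbN.
have s_inj : injective (fun i : 'I_m.+1 => nth ord0 u i).
  by move=> i j /eqP; rewrite nth_uniq ?size_u// => /eqP/val_inj.
exists (perm s_inj) => i; rewrite permE /= nth_cat size_codom card_ord ltn_ord.
by rewrite (nth_map i) ?size_enum_ord// nth_ord_enum.
Qed.

(** The permutation rule yields the image of a set under reindexing. This is what
    shows that a set described by a condition on the permuted tuples is such an
    image. *)
Lemma reindex_perm_surj k (F : 'I_k -> Type) (s : 'S_k)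
    (f : forall i, F (s i)) : exists g : forall i, F i, f = fun i => g (s i).
Proof.
exists (fun j => ecast j' (F j') (permKV s j) (f (s^-1%g j))).
apply: functional_extensionality_dep => i.
move: (permKV s (s i)); rewrite permK => e.
by rewrite (eq_axiomK e).
Qed.

Section Reindexing.
Context {R : realType} {L : rv_logic R} {tau : vocabulary} {M : pointedType}.
Implicit Types (MM : model R tau M) (delta gamma : md_sentence L tau M)
  (Gamma : set (md_sentence L tau M)).

(** Permuting by [s^-1] undoes [s] only up to the equality of
    [s (s^-1 i)] with [i], which is not a conversion; it is rewritten as an
    equality of functions so that the formulas and the maps change together. *)
Lemma derives_perm_inv Gamma k (phi : 'I_k.+1 -> formula L tau) (s : 'S_k.+1)
    (S : set (forall i, fmap M (phi i))) :
  derives Gamma (MD (fun i => phi (s i)) [set (fun i => f (s i)) | f in S]) ->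
  derives Gamma (MD phi S).
Proof.
move=> der.
have : derives Gamma (MD (fun i => phi (s (s^-1 i)%g))
    [set (fun i => f (s (s^-1 i)%g)) | f in S]).
  apply: derives_infer; apply: Rule_weaken; last first.
    by apply: derives_infer; apply: (Rule_perm s^-1%g der).
  by move=> _ [_ [f Sf <-] <-]; exists f.
pose g i := s (s^-1 i)%g.
have eg : g = id by apply: functional_extensionality_dep => i; exact: permKV.
rewrite -[X in X -> _]/(derives Gamma (MD (fun i => phi (g i))
  [set (fun i => f (g i)) | f in S])) eg.
by rewrite image_id.
Qed.


(** Along a permutation that extends [h], the components of [delta] become an
    initial segment of the list, where extension applies. The set obtained is
    described by its models, which is all that completeness uses. *)
Lemma derives_pullback Gamma delta m (phi : 'I_m.+1 -> formula L tau)
    (h : 'I_(md_len delta).+1 -> 'I_m.+1) :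
  injective h -> md_form delta = (fun i => phi (h i)) -> derives Gamma delta ->
  exists2 S, derives Gamma (MD phi S) &
    forall MM, S (fun i => defined_map MM (phi i)) <-> satisfies MM delta.
Proof.
case: delta h => k F S0 /= h h_inj eF.
have le_km : k.+1 <= m.+1.
  by rewrite -[k.+1]card_ord -[m.+1]card_ord; exact: leq_card h_inj.
have [s sh] := perm_extending_inj le_km h_inj.
have {}eF : F = fun i => phi (s (widen_ord le_km i)).
  by rewrite eF; apply: functional_extensionality_dep => i; rewrite sh.
subst F => der.
exists [set f | S0 (fun i => f (s (widen_ord le_km i)))] => //.
apply: (derives_perm_inv (s := s)); apply: derives_infer.
have : derives Gamma (MD (fun i => phi (s i))
    [set f | S0 (fun i => f (widen_ord le_km i))]).
  by apply: derives_infer; exact: (@Rule_extend _ _ _ _ _ k m le_km).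
apply: Rule_weaken => f S0f.
have [g fg] := reindex_perm_surj (F := fun i => fmap M (phi i)) f.
by exists g => //; move: S0f; rewrite fg.
Qed.

(** The converse move: the components of [gamma] are permuted to the front and
    the rest is projected away. Every projected tuple is defined by a model of
    [gamma], so it is in the set of [gamma] and weakening applies. The strict
    bound is there because projection must drop a component. *)
Lemma derives_restrict Gamma gamma m (phi : 'I_m.+1 -> formula L tau)
    (h : 'I_(md_len gamma).+1 -> 'I_m.+1) S :
  md_len gamma < m ->
  injective h -> md_form gamma = (fun i => phi (h i)) ->
  derives Gamma (MD phi S) ->
  (forall f, S f -> exists2 MM, f = (fun i => defined_map MM (phi i)) &
                                satisfies MM gamma) ->
  derives Gamma gamma.
Proof.
case: gamma h => k F S0 /= h lt_km h_inj eF der SMM.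
have [s sh] := perm_extending_inj (ltnW (lt_km : k.+1 < m.+1)) h_inj.
have {}eF : F = fun i => phi (s (widen_ord (ltnW (lt_km : k.+1 < m.+1)) i)).
  by rewrite eF; apply: functional_extensionality_dep => i; rewrite sh.
subst F.
have derp := derives_infer (Rule_project (lt_km : k.+1 < m.+1)
  (derives_infer (Rule_perm s der))).
apply: derives_infer; apply: Rule_weaken derp.
by move=> _ [_ [f /SMM[MM -> MMS0] <-] <-].
Qed.

Lemma derives_inter_seq Gamma m (phi : 'I_m.+1 -> formula L tau)
    (Ds : seq (md_sentence L tau M)) :
  (forall delta, delta \in Ds -> exists2 S, derives Gamma (MD phi S) &
    forall MM, S (fun i => defined_map MM (phi i)) <-> satisfies MM delta) ->
  exists2 S, derives Gamma (MD phi S) &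
    forall MM, S (fun i => defined_map MM (phi i)) <->
      forall delta, delta \in Ds -> satisfies MM delta.
Proof.
elim: Ds => [|delta Ds IH] DsP.
  by exists setT => //; apply: derives_infer; exact: Axiom_full.
have [|S1 der1 S1P] := DsP delta; first by rewrite mem_head.
have [|S2 der2 S2P] := IH.
  by move=> d dDs; apply: DsP; rewrite inE dDs orbT.
exists (S1 `&` S2); first by apply: derives_infer; exact: Rule_inter.
move=> MM; split=> [[/S1P MM1 /S2P MM2] d|MMDs].
  by rewrite inE => /predU1P[->//|]; exact: MM2.
by split; [apply/S1P/MMDs; rewrite mem_head|
  apply/S2P => d dDs; apply: MMDs; rewrite inE dDs orbT].
Qed.

End Reindexing.

(** * Good tuples come from models *)

Section Models.
Context {R : realType} {L : rv_logic R} {tau : vocabulary} {M : pointedType}.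
Implicit Types (phi psi : formula L tau) (MM : model R tau M).

Definition immediate_subformula psi phi : Prop :=
  match phi with
  | Atom _ _ | Equal _ _ _ => False
  | Conn c phis => exists i, psi = phis i
  | All _ chi | Ex _ chi => psi = chi
  end.

Fixpoint subformulas phi : seq (formula L tau) :=
  phi :: match phi with
         | Atom _ _ | Equal _ _ _ => [::]
         | Conn _ phis => flatten [seq subformulas (phis i) | i : 'I_ _]
         | All _ psi | Ex _ psi => subformulas psi
         end.

Lemma subformulas_refl phi : phi \in subformulas phi.
Proof. by case: phi => *; rewrite mem_head. Qed.

(** Closing a list by [subformulas] once makes it closed. *)
Lemma subformulas_closed phi psi chi : psi \in subformulas phi ->
  immediate_subformula chi psi -> chi \in subformulas phi.
Proof.
elim: phi => [P xs|h x y|c ps IH|y phi IH|y phi IH] /=; rewrite inE;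
  [by move=> /eqP-> | by move=> /eqP-> | | |]; move=> /predU1P[->|] /=.
- move=> [i ->]; rewrite inE; apply/orP; right.
  by apply/flatten_mapP; exists i; rewrite ?mem_enum ?subformulas_refl.
- move=> /flatten_mapP[i _ psii] chipsi; rewrite inE; apply/orP; right.
  by apply/flatten_mapP; exists i; rewrite ?mem_enum//; exact: IH chipsi.
- by move=> ->; rewrite inE subformulas_refl orbT.
- by move=> psiphi chipsi; rewrite inE (IH psiphi chipsi) orbT.
- by move=> ->; rewrite inE subformulas_refl orbT.
- by move=> psiphi chipsi; rewrite inE (IH psiphi chipsi) orbT.
Qed.

(** Coherence makes the values on atomic formulas an interpretation of the
    predicates. The closure hypothesis lets goodness apply at each
    compound formula, so the tuple agrees with the model by induction on
    formulas. Equal formulas at several indices get equal maps for the same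
    reason: both are the map defined in the model. *)
Lemma good_has_model k (phi : 'I_k -> formula L tau)
    (f : forall i, fmap M (phi i)) :
  (forall i psi, immediate_subformula psi (phi i) -> exists j, psi = phi j) ->
  good f -> coherent_atoms f ->
  exists MM, f = fun i => defined_map MM (phi i).
Proof.
move=> phi_closed [goodC goodA goodE] [cohP cohE].
have interpP (P : pred_sym tau) (t : (pred_arity P).-tuple M) :
    {v : {i01 R} | forall i xs e, phi i = Atom P xs -> map_tuple e xs = t ->
       app (f i) e = v}.
  apply: cid.
  (* Where no listed atomic formula fixes the value, any value will do. *)
  have [[i [xs [e [phii et]]]]|nex] := pselect (exists i xs (e : nat -> M),
    phi i = Atom P xs /\ map_tuple e xs = t).
    exists (app (f i) e) => j ys e' phij e't.
    by apply: (cohP _ _ _ _ _ phij phii); rewrite et.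
  by exists (0%:i01)%R => i xs e phii et; case: nex; exists i, xs, e.
pose MM := Model (fun P t => projT1 (interpP P t)).
suff evalE psi i e : phi i = psi -> app (f i) e = eval MM psi e.
  exists MM; apply: functional_extensionality_dep => i.
  by apply: app_inj => e; rewrite app_defined_map; exact: evalE.
elim: psi i e => [P xs|h x y|c ps IH|y psi IH|y psi IH] i e phii /=.
- by case: (interpP P _) => v /= vP; exact: vP phii _.
- exact: cohE phii _.
- have subP l : {j | ps l = phi j}.
    by apply/cid/(phi_closed i); rewrite phii /=; exists l.
  pose h l := projT1 (subP l).
  have psh l : ps l = phi (h l) by exact: projT2 (subP l).
  have phih : phi i = Conn c (fun l => phi (h l)).
    by rewrite phii; congr Conn; apply: functional_extensionality_dep.
  rewrite (goodC _ _ _ phih).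
  by congr conn_fun; apply: functional_extensionality_dep => l; exact: IH.
- have [|j psij] := phi_closed i psi; first by rewrite phii.
  have phij : phi i = All y (phi j) by rewrite -psij.
  rewrite (goodA _ _ _ phij).
  by congr inf01; apply: eq_imagel => d _; exact: IH.
- have [|j psij] := phi_closed i psi; first by rewrite phii.
  have phij : phi i = Ex y (phi j) by rewrite -psij.
  rewrite (goodE _ _ _ phij).
  by congr sup01; apply: eq_imagel => d _; exact: IH.
Qed.

End Models.

(** * A common index set *)

Section CommonList.
Context {R : realType} {L : rv_logic R} {tau : vocabulary} {M : pointedType}.
Implicit Types (delta : md_sentence L tau M).

Definition md_forms delta : seq (formula L tau) := codom (md_form delta).

Lemma embed_block m (B p q : seq (formula L tau)) (x0 : formula L tau) delta :
  size B = m.+1 -> B = p ++ md_forms delta ++ q ->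
  exists2 h : 'I_(md_len delta).+1 -> 'I_m.+1, injective h &
    md_form delta = fun i => nth x0 B (h i).
Proof.
move=> sizeB eB.
have lt_h (i : 'I_(md_len delta).+1) : size p + i < m.+1.
  rewrite -sizeB eB !size_cat size_codom card_ord ltn_add2l.
  exact: leq_trans (ltn_ord i) (leq_addr _ _).
exists (fun i => Ordinal (lt_h i)); first by move=> i j [/addnI/val_inj].
apply: functional_extensionality_dep => i /=.
rewrite eB nth_cat ltnNge leq_addr /= addKn nth_cat size_codom card_ord ltn_ord.
by rewrite (nth_map i) ?size_enum_ord// nth_ord_enum.
Qed.

(** The components of each sentence get a block of their own, even when formulas
    repeat, so that the embeddings are injective. The subformulas are appended
    after all the blocks; as there is at least one, each sentence is strictly
    shorter than the list, as projection requires. *)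
Lemma common_closed_formulas delta0 (Ds : seq (md_sentence L tau M)) :
  exists m (phi : 'I_m.+1 -> formula L tau),
    (forall i psi, immediate_subformula psi (phi i) -> exists j, psi = phi j) /\
    forall delta, delta \in delta0 :: Ds ->
      md_len delta < m /\
      exists2 h : 'I_(md_len delta).+1 -> 'I_m.+1, injective h &
        md_form delta = fun i => phi (h i).
Proof.
pose A := flatten [seq md_forms d | d <- delta0 :: Ds].
pose B := A ++ flatten [seq subformulas p | p <- A].
pose x0 := md_form delta0 ord0.
have x0A : x0 \in A.
  by apply/flatten_mapP; exists delta0; rewrite ?mem_head ?codom_f.
have x0C : x0 \in flatten [seq subformulas p | p <- A].
  by apply/flatten_mapP; exists x0; rewrite ?subformulas_refl.
have BP p : p \in B -> exists2 a, a \in A & p \in subformulas a.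
  rewrite mem_cat => /orP[pA|/flatten_mapP//].
  by exists p; rewrite ?subformulas_refl.
case sizeB : (size B) => [|m].
  by have : x0 \in B by [rewrite mem_cat x0A]; rewrite (size0nil sizeB).
exists m, (fun i => nth x0 B i); split=> [i psi|delta dDs].
  have /BP[a aA ia] : nth x0 B i \in B by rewrite mem_nth// sizeB.
  move=> /(subformulas_closed ia) psia.
  have psiB : psi \in B.
    by rewrite mem_cat; apply/orP; right; apply/flatten_mapP; exists a.
  have lt_m : index psi B < m.+1 by rewrite -sizeB index_mem.
  by exists (Ordinal lt_m); rewrite /= nth_index.
have [p [q eA]] : exists p q, A = p ++ md_forms delta ++ q.
  rewrite /A; case/splitPr: dDs => D1 D2.
  exists (flatten [seq md_forms d | d <- D1]).
  exists (flatten [seq md_forms d | d <- D2]).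
  by rewrite map_cat flatten_cat.
have eB : B = p ++ md_forms delta ++
    (q ++ flatten [seq subformulas p | p <- A]).
  by rewrite /B {1}eA -!catA.
split; last exact: embed_block sizeB eB.
have : 0 < size (flatten [seq subformulas p | p <- A]) by case: (flatten _) x0C.
rewrite -[md_len delta < m]ltnS -sizeB eB !size_cat size_codom card_ord; lia.
Qed.

End CommonList.

(** * Completeness *)

Lemma finite_completeness (R : realType) (L : rv_logic R) (tau : vocabulary)
    (M : pointedType) (Gamma : set (md_sentence L tau M))
    (gamma : md_sentence L tau M) :
  finite_set Gamma -> entails Gamma gamma -> derives Gamma gamma.
Proof.
move=> /finite_seqP[Ds eGamma] Gg.
have [m [phi [phi_closed embed]]] := common_closed_formulas gamma Ds.
(* [S] holds the tuples allowed by all of [Gamma]; its good and coherent part is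
   made of tuples of models of [Gamma]. *)
have [delta dDs|S derS SP] := @derives_inter_seq _ _ _ _ Gamma m phi Ds.
  have [|_ [h h_inj eh]] := embed delta; first by rewrite inE dDs orbT.
  by apply: derives_pullback h_inj eh _; apply: derives_mem; rewrite eGamma.
have [|lt_m [h h_inj eh]] := embed gamma; first by rewrite mem_head.
apply: (derives_restrict lt_m h_inj eh (derives_infer (Rule_good derS))).
move=> f [Sf goodf cohf].
have [MM ef] := good_has_model phi_closed goodf cohf.
exists MM => //; apply: Gg => delta; rewrite eGamma /= => dDs.
by move: dDs; apply: (SP MM).1; rewrite -ef.
Qed.

Theorem theorem8 (R : realType) (L : rv_logic R) (tau : vocabulary)
    (M : pointedType) (Gamma : set (md_sentence L tau M))
    (gamma : md_sentence L tau M) :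
  finite_set Gamma -> (derives Gamma gamma <-> entails Gamma gamma).
Proof.
by move=> finGamma; split; [exact: soundness | exact: finite_completeness].
Qed.
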